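(* Let $A=[a_{ij}]\in[0,1]^{n\times m}$ and $b=[b_i]\in[0,1]^{n\times 1}$. Let $\Delta=\inf_{c\in\mathcal C}\Vert b-c\Vert$ be the Chebyshev distance associated to the second member $b$ of the system of max-Lukasiewicz fuzzy relational equations $\max_{1\le j\le m}\max(a_{ij}+x_j-1,0)=b_i$ ($1\le i\le n$), where $\mathcal C$ is the set of $c\in[0,1]^{n\times 1}$ for which the max-Lukasiewicz system with matrix $A$ and second member $c$ is consistent. Then $$\Delta=\max_{1\le i\le n}\delta_i,$$ where for $i=1,2,\dots,n$: $$\delta_i=\min_{1\le j\le m}\ \max_{1\le k\le n}\ \sigma_{L}(1-a_{ij},b_i,a_{kj},b_k).$$
   Context: $n,m\ge 1$ are integers; $[0,1]^{n\times m}$ is the set of $n\times m$ matrices with entries in $[0,1]$. The max-Lukasiewicz system with matrix $A$ and second member $c=[c_i]\in[0,1]^{n\times 1}$ is: find $x=[x_j]\in[0,1]^{m\times 1}$ with $\max_{1\le j\le m}\max(a_{ij}+x_j-1,0)=c_i$ for all $i\in\{1,\dots,n\}$; it is consistent if such an $x$ exists. $\Vert b-c\Vert=\max_{1\le i\le n}|b_i-c_i|$. For real $t$, $t^+=\max(t,0)$. For $u,x,y,z\in[0,1]$, with $v=x+u-1$, $$\sigma_L(u,x,y,z)=\min\Big(x,\ \max\Big(v^+,\ \frac{(v+y-z)^+}{2}\Big)\Big).$$ *)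

(* Defs.v *)
From HB Require Import structures.
From mathcomp Require Import all_boot all_order all_algebra.
From mathcomp Require Import boolp classical_sets reals topology normedtype.

Set Implicit Arguments.
Unset Strict Implicit.
Unset Printing Implicit Defensive.

Import Order.TTheory GRing.Theory Num.Theory.
Import numFieldNormedType.Exports.

Local Open Scope classical_set_scope.
Local Open Scope ring_scope.

(* A positive dimension is written p.+1. The maximum (minimum) of the nonempty
   family f starts from one of its own members, so no bound on the values is
   needed for it to be the actual maximum (minimum). *)
Definition fin_max (R : realType) (p : nat) (f : 'I_p.+1 -> R) : R :=
  \big[Num.max/f ord0]_(i < p.+1) f i.

Definition fin_min (R : realType) (p : nat) (f : 'I_p.+1 -> R) : R :=
  \big[Num.min/f ord0]_(i < p.+1) f i.

Definition in_unit_interval (R : realType) (p q : nat) (M : 'M[R]_(p, q)) : Prop :=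
  forall i j, 0 <= M i j <= 1.

Definition pos_part (R : realType) (t : R) : R := Num.max t 0.

Definition sigmaL (R : realType) (u x y z : R) : R :=
  let v := x + u - 1 in
  Num.min x (Num.max (pos_part v) (pos_part (v + y - z) / 2)).

Definition max_Luk_solution (R : realType) (n m : nat)
    (A : 'M[R]_(n.+1, m.+1)) (c : 'cV[R]_n.+1) (x : 'cV[R]_m.+1) : Prop :=
  in_unit_interval x /\
  forall i, fin_max (fun j => Num.max (A i j + x j 0 - 1) 0) = c i 0.

Definition max_Luk_consistent (R : realType) (n m : nat)
    (A : 'M[R]_(n.+1, m.+1)) (c : 'cV[R]_n.+1) : Prop :=
  exists x : 'cV[R]_m.+1, max_Luk_solution A c x.

Definition consistent_rhs (R : realType) (n m : nat)
    (A : 'M[R]_(n.+1, m.+1)) : set 'cV[R]_n.+1 :=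
  [set c | in_unit_interval c /\ max_Luk_consistent A c].

(* The norm on matrices is the sup norm of the entries (mx_norm). The real-valued
   inf is the true infimum here: for A with entries in [0, 1] the zero column is
   in consistent_rhs A (take x = 0), and distances are bounded below by 0. *)
Definition Chebyshev_distance (R : realType) (n m : nat)
    (A : 'M[R]_(n.+1, m.+1)) (b : 'cV[R]_n.+1) : R :=
  inf [set `|b - c| | c in consistent_rhs A].

Definition delta (R : realType) (n m : nat)
    (A : 'M[R]_(n.+1, m.+1)) (b : 'cV[R]_n.+1) (i : 'I_n.+1) : R :=
  fin_min (fun j : 'I_m.+1 =>
    fin_max (fun k : 'I_n.+1 => sigmaL (1 - A i j) (b i 0) (A k j) (b k 0))).

(* Main.v *)
(* For d >= 0, a tolerance d around b is feasible iff the largest x with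
   A x <= b + d, namely x_j = min(1, min_k (1 - a_kj + b_k + d)), reaches b - d.
   Row i reaches b_i - d iff b_i <= d or some column j satisfies
   b_i - a_ij <= d and b_i - a_ij + a_kj - b_k <= 2 d for all k, and this is
   exactly delta_i <= d. *)
Require Import Defs.
From mathcomp Require Import all_boot all_order all_algebra.
From mathcomp Require Import lra.
From mathcomp Require Import boolp reals normedtype.

Import Order.TTheory GRing.Theory Num.Theory.
Import numFieldNormedType.Exports.

Local Open Scope ring_scope.

Section FiniteExtrema.
Variables (R : realType) (p : nat).
Implicit Types (f : 'I_p.+1 -> R) (d : R).

Lemma fin_max_leP f d : reflect (forall i, f i <= d) (fin_max f <= d).
Proof.
apply: (iffP (bigmax_leP _ _ _ _)) => [[_ fd] i|fd]; first exact: fd.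
by split=> [|i _]; exact: fd.
Qed.

Lemma fin_max_geP f d : reflect (exists i, d <= f i) (d <= fin_max f).
Proof.
apply: (iffP (bigmax_geP _ _ _ _)) => [[df|[i _ df]]|[i df]].
- by exists ord0.
- by exists i.
- by right; exists i.
Qed.

Lemma fin_min_leP f d : reflect (exists i, f i <= d) (fin_min f <= d).
Proof.
apply: (iffP (bigmin_leP _ _ _ _)) => [[fd|[i _ fd]]|[i fd]].
- by exists ord0.
- by exists i.
- by right; exists i.
Qed.

Lemma fin_min_geP f d : reflect (forall i, d <= f i) (d <= fin_min f).
Proof.
apply: (iffP (bigmin_geP _ _ _ _)) => [[_ df] i|df]; first exact: df.
by split=> [|i _]; exact: df.
Qed.

End FiniteExtrema.

Arguments fin_max_leP {R p f d}.
Arguments fin_max_geP {R p f d}.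
Arguments fin_min_leP {R p f d}.
Arguments fin_min_geP {R p f d}.

Lemma cV_norm_leP (R : realType) (n : nat) (x : 'cV[R]_n) (d : R) :
  0 <= d -> reflect (forall i, `|x i 0| <= d) (`|x| <= d).
Proof.
move=> d0; rewrite [`|x|]/Num.Def.normr /= mx_normrE.
apply: (iffP (bigmax_leP _ _ _ _)) => [[_ xd] i|xd]; first exact: (xd (i, 0)).
by split=> // -[i j] _ /=; rewrite ord1; exact: xd.
Qed.

(** Since [d] is nonnegative, a positive part is at most [d] iff its argument is; the halved term
    turns into the bound [2 * d]. *)
Lemma sigmaL_leP (R : realType) (u x y z d : R) : 0 <= d ->
  reflect (x <= d \/ x + u - 1 <= d /\ x + u - 1 + y - z <= 2 * d)
          (sigmaL u x y z <= d).
Proof.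
move=> d0; rewrite /sigmaL /pos_part ge_min ge_max ler_pdivrMr ?ltr0n //.
rewrite !ge_max d0 mulr_ge0 // !andbT [d * 2]mulrC.
by apply: (iffP orP) => -[xd|vd];
  [left|right; apply/andP|left|right; apply/andP].
Qed.

Lemma delta_leP (R : realType) (n m : nat) (A : 'M[R]_(n.+1, m.+1))
    (b : 'cV[R]_n.+1) (i : 'I_n.+1) (d : R) : 0 <= d ->
  reflect (exists j, forall k, b i 0 <= d \/
             b i 0 - A i j <= d /\ b i 0 - A i j + A k j - b k 0 <= 2 * d)
          (delta A b i <= d).
Proof.
move=> d0; rewrite /delta.
apply: (iffP fin_min_leP) => -[j hj]; exists j.
  move=> k; move/fin_max_leP: hj => /(_ k) /(sigmaL_leP _ _ _ _ _ _ d0).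
  by case=> [bd|[h1 h2]]; [left|right; split; lra].
apply/fin_max_leP => k; apply/(sigmaL_leP _ _ _ _ _ _ d0).
by case: (hj k) => [bd|[h1 h2]]; [left|right; split; lra].
Qed.

(** Supplies the sign condition on the tolerance that the characterization of [delta A b i <= d]
    requires. *)
Lemma delta_ge0 (R : realType) (n m : nat) (A : 'M[R]_(n.+1, m.+1))
    (b : 'cV[R]_n.+1) (i : 'I_n.+1) : 0 <= b i 0 -> 0 <= delta A b i.
Proof.
move=> b0; apply/fin_min_geP => j; apply/fin_max_geP; exists ord0.
by rewrite /sigmaL /pos_part le_min b0 !le_max lexx orbT.
Qed.

Section ChebyshevDistance.
Variables (R : realType) (n m : nat).
Variables (A : 'M[R]_(n.+1, m.+1)) (b : 'cV[R]_n.+1).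

(** A column [j] attaining the maximum in row [i] of the system for [c] is the witness. There
    [x j 0 <= 1] gives the first inequality. Eliminating [x j 0] between rows [i] and [k] gives the
    second, each row contributing one error [d]. *)
Lemma delta_le_dist (c : 'cV[R]_n.+1) (i : 'I_n.+1) :
  consistent_rhs A c -> delta A b i <= `|b - c|.
Proof.
move=> [_ [x [x01 Axc]]]; set d := `|b - c|.
have d0 : 0 <= d by rewrite /d.
have bcd k : - d <= b k 0 - c k 0 <= d.
  have /(cV_norm_leP _ _ _ _ d0) /(_ k) : `|b - c| <= d by [].
  by rewrite !mxE ler_norml.
have xc k j : A k j + x j 0 - 1 <= c k 0.
  have /fin_max_leP /(_ j) :
      fin_max (fun j => Num.max (A k j + x j 0 - 1) 0) <= c k 0 by rewrite Axc.
  by rewrite ge_max => /andP[].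
have /fin_max_geP [j] :
    c i 0 <= fin_max (fun j => Num.max (A i j + x j 0 - 1) 0).
  by rewrite Axc.
have /andP[_ xj1] := x01 j 0.
have /andP[_ bci] := bcd i.
rewrite le_max => /orP cij; apply/delta_leP => //; exists j => k.
(* If row [i] attains its maximum at the truncation value 0, then [c i 0 <= 0], so [b i 0 <= d]. *)
case: cij => cij; last by left; lra.
have /andP[bck _] := bcd k; have := xc k j.
by right; split; lra.
Qed.

(** Taken at [d] equal to the largest [delta], this shows that the infimum is attained. *)
Lemma max_Luk_approx (d : R) : in_unit_interval A -> in_unit_interval b ->
  (forall i, delta A b i <= d) ->
  exists2 c, consistent_rhs A c & `|b - c| <= d.
Proof.
move=> hA hb bd.
have d0 : 0 <= d.
  by apply: le_trans (bd ord0); apply: delta_ge0; case/andP: (hb ord0 0).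
(* The greatest vector with entries at most 1 whose image stays below [b + d]; the entry 1 inside
   the minimum is that cap. *)
pose x : 'cV[R]_m.+1 :=
  \col_j fin_min (fun k => Num.min 1 (1 - A k j + b k 0 + d)).
have x01 : in_unit_interval x.
  move=> j l; rewrite mxE; apply/andP; split.
    apply/fin_min_geP => k; rewrite le_min ler01 /=.
    by have /andP[_ ?] := hA k j; have /andP[? _] := hb k 0; lra.
  by apply/fin_min_leP; exists ord0; rewrite ge_min lexx.
have xbd k j : A k j + x j 0 - 1 <= b k 0 + d.
  have /fin_min_geP /(_ k) :
    x j 0 <= fin_min (fun k => Num.min 1 (1 - A k j + b k 0 + d)) by rewrite mxE.
  by rewrite le_min => /andP[_]; lra.
(* Taking [c] to be the image of [x] makes the system consistent by construction; only the distance
   to [b] remains to be bounded. *)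
pose c : 'cV[R]_n.+1 :=
  \col_i fin_max (fun j => Num.max (A i j + x j 0 - 1) 0).
exists c.
  split; last by exists x; split=> // i; rewrite [RHS]mxE.
  move=> i l; rewrite mxE; apply/andP; split.
    by apply/fin_max_geP; exists ord0; rewrite le_max lexx orbT.
  apply/fin_max_leP => j; rewrite ge_max ler01 andbT.
  by have /andP[_ ?] := hA i j; have /andP[_ ?] := x01 j 0; lra.
apply/cV_norm_leP => // i; rewrite !mxE ler_norml.
have cbd : c i 0 <= b i 0 + d.
  rewrite mxE; apply/fin_max_leP => j; rewrite ge_max xbd /=.
  by have /andP[? _] := hb i 0; lra.
suff bcd : b i 0 - d <= c i 0.
  by move: cbd bcd; rewrite !mxE => cbd bcd; apply/andP; split; lra.
have /delta_leP -/(_ d0) [j hj] := bd i.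
rewrite mxE; apply/fin_max_geP; exists j; rewrite le_max; apply/orP.
have [bid|dbi] := leP (b i 0) d; first by right; lra.
(* This is the value of [x j 0] at which column [j] reaches [b i 0 - d]. It is below the cap 1 by
   the first inequality of [hj], and below the bound from row [k] by the second. *)
left; suff : b i 0 - d - A i j + 1 <= x j 0 by lra.
rewrite mxE; apply/fin_min_geP => k; rewrite le_min.
by case: (hj k) => [|[h1 h2]]; first lra; apply/andP; split; lra.
Qed.

End ChebyshevDistance.

Theorem theorem5 (R : realType) (n m : nat)
    (A : 'M[R]_(n.+1, m.+1)) (b : 'cV[R]_n.+1)
    (hA : in_unit_interval A) (hb : in_unit_interval b) :
  Chebyshev_distance A b = fin_max (fun i : 'I_n.+1 => delta A b i).
Proof.
set D := fin_max _.
have [c Cc bcD] : exists2 c, consistent_rhs A c & `|b - c| <= D.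
  by apply: max_Luk_approx => //; exact/fin_max_leP.
apply/eqP; rewrite eq_le; apply/andP; split.
  apply: le_trans bcD; apply: ge_inf; last by exists c.
  by exists 0 => _ [c' _ <-].
(* The approximant [c] serves again, now to show that the set of distances is nonempty. *)
apply: lb_le_inf; first by exists `|b - c|, c.
by move=> _ [c' Cc' <-]; apply/fin_max_leP => i; exact: delta_le_dist.
Qed.
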